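(* Let $P$ be a uniformly Lubell-bounded poset, let $k\ge 1$ be an integer, and let $\mathcal{F}\subseteq B_n$ be a family of sets with $\lambda_n(\mathcal{F})>e(P)(k-1)$. Then any coloring $\phi:\mathcal{F}\rightarrow \mathbb{N}$ admits either a monochromatic weak copy of $P$ or a rainbow copy of $C_k$.
   Context: All posets are finite and non-empty. $B_n$ is the Boolean lattice of all subsets of $[n]=\{1,\dots,n\}$ ordered by inclusion; a level of $B_n$ is the collection of all sets of a given size. $C_k$ is the chain (totally ordered set) on $k$ elements. A subset $X$ of a poset $Q$ is a weak copy of a poset $P$ if there is a bijection $\alpha:P\to X$ such that $p\le_P p'$ implies $\alpha(p)\le_Q\alpha(p')$. A copy $X$ is monochromatic with respect to a coloring if all its elements have the same color, and rainbow if its elements have pairwise distinct colors. A family $\mathcal{F}\subseteq B_n$ is $P$-free if it contains no weak copy of $P$. $e(P)$ is the maximum number $m$ such that for every $n$ the union of any $m$ consecutive levels of $B_n$ is $P$-free. The Lubell-mass of $\mathcal{F}\subseteq B_n$ is $\lambda_n(\mathcal{F})=\sum_{F\in\mathcal{F}}\binom{n}{|F|}^{-1}$, and $\lambda_n(P)$ is the maximum of $\lambda_n(\mathcal{F})$ over all $P$-free families $\mathcal{F}\subseteq B_n$. $P$ is uniformly Lubell-bounded if $e(P)\ge\lambda_n(P)$ for all positive integers $n$. *)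

(* Defs.v *)
From mathcomp Require Import all_boot all_order all_algebra.
From mathcomp Require Import boolp.
Set Implicit Arguments.
Unset Strict Implicit.
Unset Printing Implicit Defensive.
Import Order.TTheory GRing.Theory Num.Theory.
(* Orders {set T} by inclusion: the Boolean lattice B_n is {set 'I_n}. *)
Import Order.DefaultSetSubsetOrder.
Local Open Scope ring_scope.

Definition weak_copy d d' (P : finPOrderType d) (Q : finPOrderType d')
    (X : {set Q}) : Prop :=
  exists alpha : P -> Q,
    [/\ injective alpha, alpha @: [set: P] = X
      & {homo alpha : p p' / (p <= p')%O}].
Arguments weak_copy {d d'} P {Q} X.

Definition monochromatic (T : finType) (phi : T -> nat) (X : {set T}) : Prop :=
  {in X &, forall x y, phi x = phi y}.

Definition rainbow (T : finType) (phi : T -> nat) (X : {set T}) : Prop :=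
  {in X &, injective phi}.

Definition is_free d (P : finPOrderType d) n (F : {set {set 'I_n}}) : Prop :=
  ~ exists2 X : {set {set 'I_n}}, X \subset F & weak_copy P X.
Arguments is_free {d} P {n} F.

(* The union of the m levels i, i + 1, ..., i + m - 1 of B_n. *)
Definition levels n i m : {set {set 'I_n}} :=
  [set A : {set 'I_n} | (i <= #|A| < i + m)%N].

(* i + m <= n.+1 says that all m levels lie in B_n, whose levels are 0..n. *)
Definition levels_free d (P : finPOrderType d) (m : nat) : Prop :=
  forall n i, (i + m <= n.+1)%N -> is_free P (levels n i m).

(* The bound m < #|P| discards no candidate when P is non-empty, see e_numP. *)
Definition e_num d (P : finPOrderType d) : nat :=
  \max_(m < #|P| | `[< levels_free P m >]) m.

Definition lubell n (F : {set {set 'I_n}}) : rat :=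
  \sum_(A in F) ('C(n, #|A|)%:R)^-1.

(* The default value 0 is the mass of the empty family, which is P-free when P
   is non-empty; see lubell_maxP. *)
Definition lubell_max d (P : finPOrderType d) (n : nat) : rat :=
  \big[Num.max/0]_(F : {set {set 'I_n}} | `[< is_free P F >]) lubell F.

Definition uniformly_lubell_bounded d (P : finPOrderType d) : Prop :=
  forall n, (0 < n)%N -> lubell_max P n <= (e_num P)%:R.

Lemma is_free0 d (P : finPOrderType d) n :
  (0 < #|P|)%N -> is_free P (set0 : {set {set 'I_n}}).
Proof.
move=> /card_gt0P[p _] [X]; rewrite subset0 => /eqP-> [a [_ a0 _]].
by have := imset_f a (in_setT p); rewrite a0 inE.
Qed.

Lemma levels_free_bound d (P : finPOrderType d) m :
  levels_free P m -> (m < #|P|)%N.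
Proof.
move=> Pm; rewrite ltnNge; apply/negP => leP.
pose f (p : P) : 'I_m := widen_ord leP (enum_rank p).
have f_inj : injective f.
  by move=> p q /(congr1 val) /= /ord_inj /enum_rank_inj.
pose a (p : P) : {set 'I_m} := f @: [set q : P | (q <= p)%O].
have in_a p q : (f q \in a p) = (q <= p)%O.
  by rewrite mem_imset ?inE.
apply: (Pm m 1%N); first by rewrite add1n.
exists (a @: [set: P]).
  apply/subsetP => _ /imsetP[p _ ->]; rewrite inE add1n ltnS.
  have := max_card (mem (a p)); rewrite card_ord => ->; rewrite andbT.
  apply/card_gt0P.
  by exists (f p); rewrite in_a.
exists a; split=> // [p q eq_a|p q le_pq].
  by apply/le_anti; rewrite -in_a -eq_a in_a lexx -in_a eq_a in_a lexx.
apply/subsetP => _ /imsetP[r + ->]; rewrite inE => le_rp.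
by rewrite in_a (le_trans le_rp).
Qed.

Lemma e_numP d (P : finPOrderType d) : (0 < #|P|)%N ->
  levels_free P (e_num P) /\ forall m, levels_free P m -> (m <= e_num P)%N.
Proof.
move=> P0; split.
  have P0_free : levels_free P 0.
    move=> n i _; rewrite (_ : levels n i 0 = set0); first exact: is_free0.
    by apply/setP => A; rewrite !inE addn0; case: ltngtP.
  rewrite /e_num; elim/big_ind: _ => // [x y Px Py|m /asboolP //].
  by rewrite /maxn; case: ifP.
move=> m Pm; have m_lt := levels_free_bound Pm.
by apply: (leq_bigmax_cond (Ordinal m_lt)); apply/asboolP.
Qed.

Lemma lubell_maxP d (P : finPOrderType d) n : (0 < #|P|)%N ->
  (exists2 F : {set {set 'I_n}}, is_free P F & lubell F = lubell_max P n) /\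
  forall F : {set {set 'I_n}}, is_free P F -> lubell F <= lubell_max P n.
Proof.
move=> P0; split; last first.
  by move=> F /asboolP PF; rewrite /lubell_max; apply: le_bigmax_cond.
rewrite /lubell_max; elim/big_ind: _ => [|x y [F PF <-] [G PG <-]|F /asboolP].
- by exists set0; [exact: is_free0|rewrite /lubell big_set0].
- by rewrite maxEle; case: ifP => _; [exists G|exists F].
- by exists F.
Qed.

(* Main.v *)
(* Call sum_(B in F, B <= A) 1 / C(|A|, |B|) the Lubell mass of F relative to A:
   it is the mean number of members of F on a random full chain of [0, A].
   Conditioning on the largest member M of F on the chain shows that a bound
   valid relative to every M in F is valid relative to every set.  Assume that
   the color classes are P-free.  Relative to M, the class of M has mass at most
   e(P), and the members of F below M with another color contain no rainbow
   chain of size k - 1 if F contains none of size k; so induction on k gives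
   e(P) (k - 1) as a bound. *)
Require Import Defs.
From mathcomp Require Import all_boot all_order all_algebra.
From mathcomp Require Import boolp.
Set Implicit Arguments.
Unset Strict Implicit.
Unset Printing Implicit Defensive.
Import Order.TTheory GRing.Theory Num.Theory.
Import Order.DefaultSetSubsetOrder.
Local Open Scope ring_scope.

Definition rel_lubell (T : finType) (F : {set {set T}}) (A : {set T}) : rat :=
  \sum_(B in F | B \subset A) ('C(#|A|, #|B|)%:R)^-1.

Lemma lubellE n (F : {set {set 'I_n}}) : lubell F = rel_lubell F setT.
Proof.
rewrite /lubell /rel_lubell cardsT card_ord.
by apply: eq_bigl => B; rewrite subsetT andbT.
Qed.

(** This is one step of the random chain, which goes from [A] down to [A :\ x] with [x] uniform in
    [A]. A proper subset [B] remains below for the [#|A| - #|B|] choices of [x] outside [B]. *)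
Lemma rel_lubell_proper (T : finType) (F : {set {set T}}) (A : {set T}) :
  #|A|%:R * (\sum_(B in F | B \proper A) ('C(#|A|, #|B|)%:R)^-1) =
  \sum_(x in A) rel_lubell F (A :\ x).
Proof.
rewrite (exchange_big_dep (fun B => (B \in F) && (B \proper A))) /=; last first.
  move=> x B xA /andP[-> BAx]; rewrite properE (subset_trans BAx (subsetDl _ _)).
  by apply/subsetPn; exists x => //; apply/negP => /(subsetP BAx);
    rewrite !inE eqxx.
rewrite mulr_sumr; apply: eq_bigr => B /andP[BF /[dup] ltBA /andP[BA _]].
rewrite (eq_bigr (fun=> ('C(#|A|.-1, #|B|)%:R)^-1)); last first.
  by move=> x /andP[xA _]; rewrite (cardsD1 x A) xA add1n.
rewrite (eq_bigl (mem (A :\: B))); last first.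
  by move=> x; rewrite /= BF subsetD1 BA /= !inE andbC.
rewrite sumr_const cardsD (setIidPr BA).
have ltab := proper_card ltBA; have a_gt0 := leq_ltn_trans (leq0n _) ltab.
(* Both sides count the pairs of an element of [A] and a subset of [A] of size [#|B|] avoiding
   it. *)
have e : (#|A| * 'C(#|A|.-1, #|B|) = (#|A| - #|B|) * 'C(#|A|, #|B|))%N.
  by rewrite -{1 2}(prednK a_gt0) mul_bin_diag -mul_bin_left prednK // mulnC.
have C1 : 'C(#|A|, #|B|)%:R != 0 :> rat by rewrite pnatr_eq0 -lt0n bin_gt0 ltnW.
have C2 : 'C(#|A|.-1, #|B|)%:R != 0 :> rat.
  by rewrite pnatr_eq0 -lt0n bin_gt0 -ltnS prednK.
apply: (mulIf C1); rewrite divfK //.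
rewrite -[X in _ = X * _]mulr_natl mulrAC -natrM -e natrM.
by rewrite mulfK.
Qed.

(** Induction on [#|A|] stands in for the conditioning: if [A] is not in [F], its mass is the
    average of the masses relative to the sets [A :\ x]. *)
Lemma rel_lubell_le (T : finType) (F : {set {set T}}) (t : rat) :
  0 <= t -> {in F, forall M, rel_lubell F M <= t} ->
  forall A, rel_lubell F A <= t.
Proof.
move=> t0 Ft A; have [m] := ubnP #|A|; elim: m A => // m IH A leAm.
have [/Ft //|AF] := boolP (A \in F).
have -> : rel_lubell F A =
    \sum_(B in F | B \proper A) ('C(#|A|, #|B|)%:R)^-1.
  apply: eq_bigl => B; rewrite properEneq; case: eqP => //= ->.
  by rewrite (negPf AF).
(* The empty set has no [A :\ x] to average over; the sum is then 0, and [0 <= t] concludes. *)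
have [->|/set0Pn[x0 x0A]] := eqVneq A set0.
  by rewrite big1 // => B; rewrite properE subset0 sub0set andbF andbF.
have A_gt0 : 0 < #|A|%:R :> rat by rewrite ltr0n; apply/card_gt0P; exists x0.
rewrite -(ler_pM2l A_gt0) rel_lubell_proper mulr_natl -sumr_const.
apply: ler_sum => x xA; apply: IH.
by move: leAm; rewrite (cardsD1 x A) xA add1n.
Qed.

Lemma weak_copy_imset d d1 d2 (P : finPOrderType d) (Q : finPOrderType d1)
    (R : finPOrderType d2) (h : Q -> R) (X : {set Q}) :
  {in X &, injective h} -> {homo h : x y / (x <= y)%O} ->
  weak_copy P X -> weak_copy P (h @: X).
Proof.
move=> h_inj h_homo [a [a_inj aX a_homo]]; rewrite -aX in h_inj *.
exists (h \o a); split=> [p q /= /h_inj eq_a||p q /a_homo /h_homo //].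
  by apply: a_inj; apply: eq_a; apply: imset_f.
by rewrite imset_comp.
Qed.

Lemma is_freeS d (P : finPOrderType d) n (F G : {set {set 'I_n}}) :
  F \subset G -> is_free P G -> is_free P F.
Proof.
by move=> FG PG [X XF PX]; apply: PG; exists X => //; apply: subset_trans FG.
Qed.

(** Injectivity is asked on [F] only, so that a constant map can serve for a one-member family. *)
Lemma is_free_preim d (P : finPOrderType d) m n
    (h : {set 'I_m} -> {set 'I_n}) (F : {set {set 'I_m}}) (G : {set {set 'I_n}}) :
  {in F &, injective h} -> {homo h : A B / A \subset B} ->
  {in F, forall A, h A \in G} -> is_free P G -> is_free P F.
Proof.
move=> h_inj h_homo FG PG [X /subsetP XF PX]; apply: PG; exists (h @: X).
  by apply/subsetP => _ /imsetP[A /XF AF ->]; apply: FG.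
apply: weak_copy_imset PX; first exact: sub_in2 h_inj.
exact: h_homo.
Qed.

(** The interval [0, [A]] is a copy of the Boolean lattice of dimension [#|A|], to which the uniform
    bound on [P] applies. *)
Lemma rel_lubell_free d (P : finPOrderType d) n (G : {set {set 'I_n}}) A :
  (0 < #|P|)%N -> uniformly_lubell_bounded P -> is_free P G ->
  rel_lubell G A <= (e_num P)%:R.
Proof.
move=> P0 Pb PG.
have bound m (F : {set {set 'I_m}}) : (0 < m)%N -> is_free P F ->
    lubell F <= (e_num P)%:R.
  by move=> m0 PF; apply: le_trans (Pb m m0); apply: (lubell_maxP m P0).2.
have [A0|A_gt0] := posnP #|A|.
  (* Here [0, A] is B_0, to which the hypothesis on P does not apply; the family
     consisting of the empty set is moved to B_1. *)
  rewrite (cards0_eq A0); have [G0|G0] := boolP (set0 \in G); last first.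
    rewrite /rel_lubell big1 // => B /andP[BG]; rewrite subset0 => /eqP B0.
    by rewrite -B0 BG in G0.
  have PF : is_free P [set (set0 : {set 'I_1})].
    apply: (@is_free_preim _ _ _ _ (fun=> set0) _ G) => //.
    by move=> B C; rewrite !inE => /eqP-> /eqP->.
  apply: le_trans (bound _ _ _ PF) => //.
  rewrite /lubell big_set1 /rel_lubell !cards0 !bin0.
  rewrite (big_pred1 set0) ?cards0 ?bin0 //.
  by move=> B; rewrite subset0 andbC /=; case: eqP => // ->.
pose h (S : {set 'I_#|A|}) : {set 'I_n} := enum_val @: S.
have h_inj : injective h by apply: imset_inj; apply: enum_val_inj.
have hS S : h S \subset A.
  by apply/subsetP => _ /imsetP[i _ ->]; apply: enum_valP.
have PF : is_free P (h @^-1: G).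
  apply: (@is_free_preim _ _ _ _ h _ G) => //; first exact: in2W.
    by move=> S S'; apply: imsetS.
  by move=> S; rewrite inE.
apply: le_trans (bound _ _ A_gt0 PF).
(* [h] preserves cardinality and maps [h @^-1: G] bijectively onto the members of [G] inside [A], so
   the masses agree term by term. *)
rewrite le_eqVlt; apply/orP; left; apply/eqP; rewrite /rel_lubell /lubell.
have -> : \sum_(S in h @^-1: G) ('C(#|A|, #|S|)%:R)^-1 =
    \sum_(S in h @^-1: G) ('C(#|A|, #|h S|)%:R)^-1 :> rat.
  by apply: eq_bigr => S _; rewrite card_imset //; apply: enum_val_inj.
rewrite -[RHS](big_imset (fun B : {set 'I_n} => ('C(#|A|, #|B|)%:R)^-1)) /=;
  last exact: in2W.
apply: eq_bigl => B; apply/andP/imsetP => [[BG BA]|[S + ->]]; last first.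
  by rewrite inE => ->; rewrite hS.
suff hB : B = h (enum_val @^-1: B).
  by exists (enum_val @^-1: B); rewrite // inE -hB.
apply/setP => x; apply/idP/imsetP => [xB|[i + ->]]; last by rewrite inE.
have xA := subsetP BA x xB.
by exists (enum_rank_in xA x); rewrite ?inE enum_rankK_in.
Qed.

(** Sets are listed from the largest down, so that a new top goes at the head. Distinct colors make
    the inclusions strict. *)
Definition rainbow_chain (T : finType) (phi : {set T} -> nat)
    (F : {set {set T}}) (s : seq {set T}) : bool :=
  [&& all (mem F) s, pairwise (fun A B : {set T} => B \subset A) s
    & uniq (map phi s)].

(** Here [k] is one less than in the theorem. [F] and [A] stay general, since the induction
    hypothesis is applied to a subfamily relative to a member of [F]. *)
Lemma rel_lubell_rainbow d (P : finPOrderType d) n (phi : {set 'I_n} -> nat) k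
    (F : {set {set 'I_n}}) A :
  (0 < #|P|)%N -> uniformly_lubell_bounded P ->
  (forall c, is_free P [set B in F | phi B == c]) ->
  (forall s, rainbow_chain phi F s -> size s != k.+1) ->
  rel_lubell F A <= (e_num P)%:R * k%:R.
Proof.
move=> P0 Pb; elim: k => [|k IH] in F A * => PF noF.
  (* A single member of [F] would be a rainbow chain of size 1, so [F] is empty. *)
  rewrite /rel_lubell big1 ?mulr0 // => B /andP[BF _].
  by have := noF [:: B]; rewrite /rainbow_chain /= BF => /(_ isT).
apply: rel_lubell_le => [|M MF]; first by rewrite mulr_ge0.
pose G := [set B in F | (B \subset M) && (phi B != phi M)].
have -> : rel_lubell F M =
    rel_lubell [set B in F | phi B == phi M] M + rel_lubell G M.
  rewrite /rel_lubell (bigID (fun B => phi B == phi M)) /=.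
  congr (_ + _); apply: eq_bigl => B; rewrite !inE; first by rewrite andbAC.
  by rewrite [RHS]andbAC -!andbA; case: (B \subset M); rewrite ?andbF.
rewrite -natr1 mulrDr mulr1 addrC lerD ?rel_lubell_free //.
apply: IH => [c|s /and3P[/allP sG ss us]].
  apply: is_freeS (PF c); apply/subsetP => B.
  by rewrite !inE => /andP[/andP[-> _] ->].
have := noF (M :: s); rewrite /rainbow_chain /= MF ss us /= eqSS; apply.
rewrite !andbT; apply/and3P; split.
- by apply/allP => B /sG; rewrite /= inE => /andP[].
- by apply/allP => B /sG; rewrite /= inE => /and3P[].
- apply/mapP => -[B /sG]; rewrite /= inE => /and3P[_ _ nB] eqB.
  by rewrite eqB eqxx in nB.
Qed.

Lemma rainbow_chain_copy n (phi : {set 'I_n} -> nat) (F : {set {set 'I_n}}) s :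
  rainbow_chain phi F s ->
  exists X : {set {set 'I_n}},
    [/\ X \subset F, weak_copy 'I_(size s) X & rainbow phi X].
Proof.
move=> /and3P[/allP sF /(pairwiseP set0) ss us].
(* [s] decreases while the ordinals increase, hence the reversal. *)
pose a (i : 'I_(size s)) := nth set0 s (rev_ord i).
have phi_a i j : phi (a i) = phi (a j) -> i = j.
  rewrite /a -!(nth_map set0 0%N) // => /eqP.
  by rewrite nth_uniq ?size_map // => /eqP /ord_inj /rev_ord_inj.
exists (a @: setT); split.
- by apply/subsetP => _ /imsetP[i _ ->]; apply: sF; apply: mem_nth.
- exists a; split=> // [i j /(congr1 phi) /phi_a //|i j].
  rewrite leEord leq_eqVlt => /predU1P[/ord_inj-> //|lt_ij].
  by apply: ss; rewrite ?inE ?ltn_ord //= ltn_sub2l // (leq_ltn_trans lt_ij).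
- by move=> _ _ /imsetP[i _ ->] /imsetP[j _ ->] /phi_a ->.
Qed.

Theorem theorem1p4 (d : Order.disp_t) (P : finPOrderType d)
    (P_nonempty : (0 < #|P|)%N) (P_ulb : uniformly_lubell_bounded P)
    (k : nat) (k_ge1 : (1 <= k)%N)
    (n : nat) (F : {set {set 'I_n}})
    (F_mass : (e_num P)%:R * (k%:R - 1) < lubell F)
    (phi : {set 'I_n} -> nat) :
  (exists X : {set {set 'I_n}},
      [/\ X \subset F, weak_copy P X & monochromatic phi X])
  \/
  (exists X : {set {set 'I_n}},
      [/\ X \subset F, weak_copy 'I_k X & rainbow phi X]).
Proof.
have [|no_mono] := pselect (exists X : {set {set 'I_n}},
    [/\ X \subset F, weak_copy P X & monochromatic phi X]); first by left.
right; apply: contrapT => no_rainbow.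
case: k k_ge1 F_mass no_rainbow => // k _ + no_rainbow.
rewrite -natr1 addrK lubellE ltNge => /negP; apply.
(* A copy of [P] inside one color class would be monochromatic, so every class is free of [P]. *)
apply: (rel_lubell_rainbow (phi := phi)) => // [c [X /subsetP XF PX]|s sF].
  apply: no_mono; exists X; split=> //.
    by apply/subsetP => B /XF; rewrite inE => /andP[].
  by move=> B C /XF + /XF; rewrite !inE => /andP[_ /eqP->] /andP[_ /eqP->].
apply/eqP => size_s; apply: no_rainbow.
by rewrite -size_s; apply: rainbow_chain_copy sF.
Qed.
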